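(* Let $\mathcal{T}$ be an arbitrary finite tree with vertex set $\mathcal{V}$ and geodesic distance $\mathcal{S}$. For an integer $t\ge 1$, let $\mathcal{T}'_{t}$ be the tree obtained from $\mathcal{T}$ by applying first-order subdivision $t$ times, and let $\mathcal{S}'_{t}$ be its geodesic distance. Then $$\mathcal{S}'_{t}=8^{t}\mathcal{S}-\frac{1}{3}\left(2^{3t}-2^{t}\right)(|\mathcal{V}|-1)+\left(2^{2t-1}-2^{3t-1}\right)(|\mathcal{V}|-1)^{2}.$$
   Context: The geodesic distance of a finite connected graph $\mathcal{G}$ with vertex set $\mathcal{V}$ is the total $\mathcal{S}=\sum_{\{u,v\}} d_{uv}$, summed over all unordered pairs of distinct vertices $u,v\in\mathcal{V}$, where $d_{uv}$ is the number of edges of a shortest path joining $u$ and $v$. The first-order subdivision of a graph is the graph obtained by inserting one new vertex into every edge, i.e. replacing every edge $uv$ by a path $uwv$ of length $2$ with a new internal vertex $w$ (a distinct new vertex for each edge). Applying it $t$ times means iterating: each application subdivides every edge of the graph produced by the previous application. *)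

(* Defs.v *)
From HB Require Import structures.
From mathcomp Require Import all_boot all_order all_algebra.

Set Implicit Arguments.
Unset Strict Implicit.
Unset Printing Implicit Defensive.

Record graph := Graph {
  vertex :> finType;
  adj : rel vertex;
  adj_sym : symmetric adj;
  adj_irrefl : irreflexive adj
}.

Definition connected (G : graph) : Prop :=
  0 < #|G| /\ forall u v : G, connect (@adj G) u v.

(* A [ucycle] of size 1 is excluded by irreflexivity, and one of size 2 is
   the walk back and forth along an edge, hence the bound. *)
Definition acyclic (G : graph) : Prop :=
  forall c : seq G, ucycle (@adj G) c -> size c <= 2.

Definition is_tree (G : graph) : Prop := connected G /\ acyclic G.

Definition joined_by_path (G : graph) (u v : G) (n : nat) : bool :=
  [exists p : n.-tuple G,
    [&& path (@adj G) u p, uniq (u :: p) & last u p == v]].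

(* The least n such that some path with n edges joins u and v.  A path has
   fewer than #|G| edges, so the search range loses nothing; the value is #|G|
   when u and v are not connected. *)
Definition dist (G : graph) (u v : G) : nat :=
  find (joined_by_path u v) (iota 0 #|G|).

(* The enumeration order of G selects each unordered pair of distinct
   vertices exactly once. *)
Definition geodesic_distance (G : graph) : nat :=
  \sum_(u : G) \sum_(v : G | enum_rank u < enum_rank v) dist u v.

Definition edges (G : graph) : {set {set G}} :=
  [set [set p.1; p.2] | p : G * G & adj p.1 p.2].

(* Each edge is its own new vertex, adjacent to exactly its two endpoints. *)
Definition subdiv_vertex (G : graph) : finType :=
  (G + {e : {set G} | e \in edges G})%type.

Definition subdiv_adj (G : graph) : rel (subdiv_vertex G) :=
  fun x y =>
    match x, y with
    | inl u, inr e => u \in val e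
    | inr e, inl u => u \in val e
    | _, _ => false
    end.

Lemma subdiv_adj_sym (G : graph) : symmetric (@subdiv_adj G).
Proof. by move=> [u|e] [v|f]. Qed.

Lemma subdiv_adj_irrefl (G : graph) : irreflexive (@subdiv_adj G).
Proof. by move=> [u|e]. Qed.

Definition subdivision (G : graph) : graph :=
  Graph (@subdiv_adj_sym G) (@subdiv_adj_irrefl G).

Definition iter_subdivision (t : nat) (G : graph) : graph :=
  iter t subdivision G.

(* Main.v *)
Require Import Defs.
From mathcomp Require Import all_boot all_order all_algebra.
From mathcomp Require Import zify ring.

Set Implicit Arguments.
Unset Strict Implicit.
Unset Printing Implicit Defensive.

(** For a tree with n vertices and geodesic distance S, one subdivision gives
    S' = 8 S - 2 n (n - 1) and n' = 2 n - 1 ([geodesic_distance_subdivision],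
    [card_subdivision]).  Solving this recurrence gives the theorem.

    The one-step identity is a computation of D'(x), the sum of the distances
    from x in the subdivided tree, in terms of the sums D(v) in the original.

    From an old vertex u, an old vertex v is at distance 2 d(u,v), and the
    midpoint of an edge ab is at distance d(u,a) + d(u,b), because one end of
    the edge is exactly one step further from u than the other.  As every edge
    joins a unique vertex v different from u to its parent, the midpoints
    contribute the sum over v of 2 d(u,v) - 1.  Hence
    D'(u) = 4 D(u) - (n - 1) ([sum_dist_old]).

    The midpoint e of ab has degree two.  Any other vertex x lies behind exactly
    one of its neighbours, so d'(a,x) + d'(b,x) = 2 d'(e,x); for x = e the left
    side is 2.  Hence D'(a) + D'(b) = 2 D'(e) + 2 ([sum_dist_degree2]), that is,
    D'(e) = 2 (D(a) + D(b)) - n ([sum_dist_new]).  Summing over all vertices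
    gives the identity; the sum over the edges ab of D(a) + D(b) is again found
    from the parents.

    Trees are handled throughout by means of level functions: f is zero at the
    root, changes by exactly one along each edge, and every other vertex has
    exactly one neighbour of lower level.  In a tree the distance to any root is
    such a function ([tree_level]); conversely its existence, for one root,
    makes the graph a tree and equals the distance to that root ([level_tree],
    [level_dist]).  So a formula for the distances from one vertex of the
    subdivision proves at once that they are right and that the subdivision is
    a tree. *)

(** * Distances as lengths of shortest paths *)

Lemma uniq_path_short (T : finType) (x : T) (s : seq T) :
  uniq (x :: s) -> size s < #|T|.
Proof. by move/card_uniqP=> /= <-; apply: max_card. Qed.

Lemma dist_le_path (G : graph) (u : G) (p : seq G) :
  path (@adj G) u p -> dist u (last u p) <= size p.
Proof.
case/shortenP=> q q_path q_uniq q_sub.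
have size_q : size q <= size p by apply: uniq_leq_size q_sub; case/andP: q_uniq.
apply: leq_trans size_q; rewrite leqNgt; apply/negP=> lt_q.
have q_short := uniq_path_short q_uniq.
have := before_find 0 lt_q; rewrite nth_iota // add0n => /existsP[].
by exists (in_tuple q); rewrite q_path q_uniq eqxx.
Qed.

Lemma dist_path (G : graph) (u v : G) :
  connect (@adj G) u v ->
  exists p, [/\ path (@adj G) u p, last u p = v & size p = dist u v].
Proof.
case/connectP=> q0 /shortenP[q q_path q_uniq _] ->.
set v' := last u q.
have q_short := uniq_path_short q_uniq.
have has_d : has (joined_by_path u v') (iota 0 #|G|).
  apply/hasP; exists (size q); first by rewrite mem_iota.
  by apply/existsP; exists (in_tuple q); rewrite q_path q_uniq eqxx.
have := nth_find 0 has_d; rewrite has_find size_iota in has_d.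
rewrite nth_iota // add0n => /existsP[p /and3P[p_path _ /eqP p_last]].
by exists p; rewrite size_tuple.
Qed.

(** A shortest path from [y] to [x], read backwards, bounds [dist x y]. *)
Lemma distC (G : graph) (u v : G) : connected G -> dist u v = dist v u.
Proof.
case=> _ conn.
suff le_dist (x y : G) : dist x y <= dist y x by apply/eqP; rewrite eqn_leq !le_dist.
have [p [p_path <- <-]] := dist_path (conn y x).
rewrite -[y in dist _ y](_ : last (last y p) (rev (belast y p)) = y); last first.
  by case: p {p_path} => //= z p; rewrite rev_cons last_rcons.
rewrite -(size_belast y p) -size_rev; apply: dist_le_path.
by rewrite rev_path (eq_path (e' := @adj G)) // => a b; rewrite adj_sym.
Qed.

(** * Level functions *)

(** The last field says in one equation that the lower neighbour [w] of [v]
    exists and is the only one. *)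
Record level_function (G : graph) (r : G) (f : G -> nat) : Prop := {
  level_root : f r = 0;
  level_adj : forall v w, adj v w -> f v = (f w).+1 \/ f w = (f v).+1;
  level_parent : forall v, v != r ->
    exists w, forall x, adj v x && (f v == (f x).+1) = (x == w)
}.

Section LevelFunction.

Variables (G : graph) (r : G) (f : G -> nat).
Hypothesis lev : level_function r f.

Lemma level_path v : exists p, [/\ path (@adj G) r p, last r p = v & size p = f v].
Proof.
have [n le_n] := ubnP (f v); elim: n v le_n => // n IH v le_n.
have [->|v_r] := eqVneq v r; first by exists [::]; rewrite (level_root lev).
have [w wP] := level_parent lev v_r.
have /andP[vw /eqP fv] : adj v w && (f v == (f w).+1) by rewrite wP.
have [|p [p_path p_last p_size]] := IH w; first by lia.
exists (rcons p v); rewrite rcons_path p_path p_last adj_sym vw.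
by rewrite last_rcons size_rcons p_size.
Qed.

(** A level grows by at most one per edge, so no path from the root to [v] is
    shorter than the level of [v]. *)
Lemma level_le_size p : path (@adj G) r p -> f (last r p) <= size p.
Proof.
elim/last_ind: p => [_|p v IH] /=; first by rewrite (level_root lev).
rewrite rcons_path last_rcons size_rcons => /andP[/IH le_p /(level_adj lev)].
by lia.
Qed.

Lemma level_dist v : dist r v = f v.
Proof.
apply/eqP; rewrite eqn_leq; apply/andP; split.
  by have [p [p_path <- <-]] := level_path v; apply: dist_le_path.
have conn : connect (@adj G) r v.
  by have [p [p_path p_last _]] := level_path v; apply/connectP; exists p.
have [p [p_path <- <-]] := dist_path conn; exact: level_le_size.
Qed.

Lemma level_parent_unique v x y :
  adj v x -> adj v y -> f x <= f v -> f y <= f v -> x = y.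
Proof.
move=> vx vy fx fy.
have ex : f v = (f x).+1 by case: (level_adj lev vx); lia.
have ey : f v = (f y).+1 by case: (level_adj lev vy); lia.
have v_r : v != r by apply/eqP=> v_r; move: ex; rewrite v_r (level_root lev).
have [w wP] := level_parent lev v_r.
have /eqP-> : x == w by rewrite -wP vx ex eqxx.
by have /eqP-> : y == w by rewrite -wP vy ey eqxx.
Qed.

Lemma level_connected : connected G.
Proof.
split=> [|u v]; first by apply/card_gt0P; exists r.
have r_conn w : connect (@adj G) r w.
  by have [p [p_path p_last _]] := level_path w; apply/connectP; exists p.
apply: connect_trans (r_conn v).
by rewrite sym_connect_sym ?r_conn //; apply/adj_sym.
Qed.

(** On a cycle, both neighbours of a vertex of maximal level would be the
    parent of that vertex. *)
Lemma level_acyclic : acyclic G.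
Proof.
move=> c /andP[c_cycle c_uniq]; rewrite leqNgt; apply/negP=> c_size.
have [x0 x0_c] : exists x0, x0 \in c.
  by case: c c_size {c_cycle c_uniq} => // x0 c; exists x0; rewrite mem_head.
pose x := [arg max_(x > x0 in c) f x].
have [x_c x_max] : x \in c /\ forall y, y \in c -> f y <= f x.
  by rewrite /x; case: arg_maxnP.
have [i c' c_rot] := rot_to x_c.
have sub_c y : (y \in x :: c') = (y \in c) by rewrite -c_rot mem_rot.
(* The cycle starts at [x]; its neighbours there are [y] and the last entry [z]. *)
move: c_cycle c_uniq c_size.
rewrite -(rot_cycle i) -(rot_uniq i) -(size_rot i) c_rot.
case: c' sub_c {c_rot} => // y c'; case/lastP: c' => // c' z sub_c.
rewrite /= !rcons_path last_rcons => /and3P[xy _ zx] /and3P[_ y_c' _] _.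
have eyz : y = z.
  apply: (level_parent_unique xy); first by rewrite adj_sym.
    by apply: x_max; rewrite -sub_c !inE eqxx orbT.
  by apply: x_max; rewrite -sub_c !inE mem_rcons mem_head !orbT.
by rewrite eyz mem_rcons mem_head in y_c'.
Qed.

Lemma level_tree : is_tree G.
Proof. by split; [exact: level_connected | exact: level_acyclic]. Qed.

End LevelFunction.

(** * Distances in a tree form a level function *)

Section TreeLevels.

Variable G : graph.
Hypothesis conn : connected G.

Lemma dist_adj (u v w : G) : adj v w -> dist u w <= (dist u v).+1.
Proof.
move=> vw; have [p [p_path p_last <-]] := dist_path (conn.2 u v).
rewrite -(size_rcons p w) -[w in dist u w](last_rcons u p).
by apply: dist_le_path; rewrite rcons_path p_path p_last.
Qed.

Lemma dist_refl (u : G) : dist u u = 0.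
Proof. by have := @dist_le_path G u [::] isT; rewrite leqn0 => /eqP. Qed.

Lemma dist_parent (u v : G) : v != u ->
  exists2 w, adj v w & dist u v = (dist u w).+1.
Proof.
move=> v_u; have [p] := dist_path (conn.2 u v).
case/lastP: p => [|p w] [].
  by move=> _ /= uv; rewrite uv eqxx in v_u.
rewrite rcons_path last_rcons size_rcons => /andP[p_path wv] def_v size_p.
rewrite {}def_v in wv.
exists (last u p); first by rewrite adj_sym.
have := dist_le_path p_path; have := dist_adj u wv; lia.
Qed.

Definition avoid (v : G) : rel G := fun x y => [&& adj x y, x != v & y != v].

(** Distances to [u] decrease along a shortest path, so one that starts at
    [w] cannot meet [v], which is at least as far from [u]. *)
Lemma connect_avoid (u v w : G) :
  w != v -> dist u w <= dist u v -> connect (avoid v) w u.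
Proof.
have [n le_n] := ubnP (dist u w); elim: n w le_n => // n IH w le_n w_v le_wv.
have [->|w_u] := eqVneq w u; first exact: connect0.
have [x wx dx] := dist_parent w_u.
have x_v : x != v by apply/eqP=> x_v; move: le_wv; rewrite dx x_v ltnn.
apply: (@connect_trans _ _ x); last by apply: IH => //; lia.
by apply: connect1; rewrite /avoid wx w_v.
Qed.

(** Otherwise a path from [x] to [y] that avoids [v] would close up to a cycle
    through [v]. *)
Lemma acyclic_neighbor (v x y : G) : acyclic G ->
  adj v x -> adj v y -> connect (avoid v) x y -> x = y.
Proof.
move=> acyc vx vy /connectP[q /shortenP[p p_path p_uniq _] def_y].
case: p p_path p_uniq def_y => // z p p_path p_uniq def_y.
have p_adj : path (@adj G) x (z :: p) by apply: sub_path p_path => a b /and3P[].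
have x_v : x != v by case/andP: p_path => /and3P[].
have v_p : v \notin z :: p.
  elim: (z :: p) x p_path {vx p_uniq def_y p_adj x_v} => //= a s IH x.
  case/andP=> /and3P[_ _ a_v] /IH v_s.
  by rewrite inE negb_or eq_sym a_v.
suff /acyc : ucycle (@adj G) (v :: x :: z :: p) by [].
rewrite /ucycle /cycle rcons_path; apply/andP; split.
  apply/andP; split; first by apply/andP.
  by rewrite adj_sym [last _ _](esym def_y).
by rewrite cons_uniq p_uniq andbT inE negb_or eq_sym x_v.
Qed.

(** Two neighbours of [v] that are no further from the root than [v] are both
    connected to the root without passing through [v], so they coincide.  This
    gives uniqueness of the parent.  It also shows that adjacent vertices cannot
    be at equal distance, since the parent of one would coincide with the
    other. *)
Lemma tree_level (r : G) : acyclic G -> level_function r (dist r).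
Proof.
move=> acyc.
have lower_unique v x y : adj v x -> adj v y ->
    dist r x <= dist r v -> dist r y <= dist r v -> x = y.
  move=> vx vy dx dy; apply: (acyclic_neighbor acyc vx vy).
  have neq z : adj v z -> z != v.
    by move=> vz; apply/eqP=> z_v; rewrite z_v adj_irrefl in vz.
  apply: connect_trans (connect_avoid (neq _ vx) dx) _.
  rewrite sym_connect_sym; first exact: connect_avoid (neq _ vy) dy.
  by move=> a b; rewrite /avoid adj_sym [(b != v) && _]andbC.
have dist_neq v w : adj v w -> dist r v <> dist r w.
  move=> vw eq_d; have [v_r|v_r] := eqVneq v r.
    move: eq_d; rewrite v_r dist_refl; have [w_r|w_r] := eqVneq w r.
      by move: vw; rewrite v_r w_r adj_irrefl.
    by have [x _ ->] := dist_parent w_r.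
  have [x vx dx] := dist_parent v_r.
  have xw : x = w by apply: (lower_unique v) => //; lia.
  by move: dx; rewrite xw eq_d => /n_Sn.
split=> [|v w vw|v v_r]; first exact: dist_refl.
  have := dist_adj r vw; have := @dist_adj r w v; rewrite adj_sym => /(_ vw).
  by have := dist_neq v w vw; lia.
have [w vw dw] := dist_parent v_r; exists w => x.
apply/andP/eqP => [[vx /eqP dx]|->]; last by rewrite vw dw eqxx.
by apply: (lower_unique v) => //; lia.
Qed.

End TreeLevels.

(** * Edges of a tree and their lower ends *)

Lemma edgeP (G : graph) (e : {set G}) :
  reflect (exists a b, adj a b /\ e = [set a; b]) (e \in edges G).
Proof.
apply: (iffP imsetP) => [[[a b]]|[a [b [ab ->]]]].
  by rewrite inE => ab ->; exists a, b.
by exists (a, b); rewrite ?inE.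
Qed.

Lemma edge_at (G : graph) (e : {set G}) (v : G) :
  e \in edges G -> v \in e -> exists2 w, adj v w & e = [set v; w].
Proof.
case/edgeP=> a [b [ab ->]] /set2P[] ->; first by exists b.
by exists a; rewrite 1?adj_sym // setUC.
Qed.

Lemma adj_neq (G : graph) (a b : G) : adj a b -> a != b.
Proof. by apply: contraTneq => ->; rewrite adj_irrefl. Qed.

Lemma sum_edge (G : graph) (a b : G) (F : G -> nat) :
  adj a b -> \sum_(x in [set a; b]) F x = F a + F b.
Proof. by move/adj_neq=> ab; rewrite big_setU1 ?inE //= big_set1. Qed.

(** Sums over the edges of a tree become sums over the vertices other than the
    root: an edge is determined by its upper end, and [p] gives its lower end. *)
Lemma level_edges (G : graph) (r : G) (f : G -> nat) :
  level_function r f ->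
  exists p : G -> G,
    [/\ forall v, v != r -> adj v (p v) /\ f v = (f (p v)).+1,
        {in [set~ r] &, injective (fun v => [set v; p v])} &
        edges G = [set [set v; p v] | v in [set~ r]]].
Proof.
move=> lev.
(* The default [v] is only ever used at the root. *)
pose p v := odflt v [pick w | adj v w && (f v == (f w).+1)].
have pP v : v != r -> adj v (p v) /\ f v = (f (p v)).+1.
  move=> v_r; have [w wP] := level_parent lev v_r.
  rewrite /p; case: pickP => [x /andP[vx /eqP fx]|/(_ w)]; first by [].
  by rewrite wP eqxx.
have p_unique v w : adj v w -> f v = (f w).+1 -> v != r /\ w = p v.
  move=> vw fv; have v_r : v != r by apply/eqP=> v_r; rewrite v_r (level_root lev) in fv.
  have [vp fp] := pP v v_r; split=> //.
  by apply: (level_parent_unique lev vw vp); lia.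
exists p; split; [exact: pP| move=> v w|].
  rewrite !inE => /pP[_ fv] /pP[_ fw] eq_e.
  have : v \in [set w; p w] by rewrite -eq_e !inE eqxx.
  have : w \in [set v; p v] by rewrite eq_e !inE eqxx.
  case/set2P=> [//|wv] /set2P[//|vw]; rewrite -wv in fv; rewrite -vw in fw; lia.
apply/setP=> e; apply/edgeP/imsetP=> [[a [b [ab ->]]]|[v]].
  case: (level_adj lev ab) => fab.
    by have [a_r ->] := p_unique a b ab fab; exists a; rewrite ?inE.
  rewrite adj_sym in ab.
  by have [b_r ->] := p_unique b a ab fab; exists b; rewrite ?inE // setUC.
by rewrite !inE => /pP[vp _] ->; exists v, (p v).
Qed.

(** Seen from [x] other than [w], one of the two neighbours of [w] is the
    parent and the other is one step further, so the distances from [x] to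
    them average to [dist w x].  The term 2 comes from [x = w]. *)
Lemma sum_dist_degree2 (G : graph) (w a b : G) :
  is_tree G -> a != b -> (forall x, adj w x = (x \in [set a; b])) ->
  \sum_(x : G) dist a x + \sum_(x : G) dist b x = 2 * \sum_(x : G) dist w x + 2.
Proof.
move=> [conn acyc] ab nbr.
have wa : adj w a by rewrite nbr !inE eqxx.
have wb : adj w b by rewrite nbr !inE eqxx orbT.
have mean x : dist a x + dist b x = 2 * dist w x + 2 * (x == w).
  rewrite ![dist _ x]distC //.
  have lev := tree_level conn x acyc.
  have := level_adj lev wa; have := level_adj lev wb.
  case: (eqVneq x w) => [->|x_w]; first by rewrite dist_refl; lia.
  rewrite eq_sym in x_w; have [p pP] := level_parent lev x_w.
  have := pP a; have := pP b; rewrite wa wb /=.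
  have /andP[] : adj w p && (dist x w == (dist x p).+1) by rewrite pP.
  rewrite nbr => /set2P[] -> dp; rewrite eqxx.
    by rewrite eq_sym in ab; rewrite (negPf ab); lia.
  by rewrite (negPf ab); lia.
rewrite -big_split (eq_bigr _ (fun x _ => mean x)) big_split /= -!big_distrr /=.
by rewrite -big_mkcond big_pred1_eq.
Qed.

(** * The subdivision of a tree *)

Section SubdividedTree.

Variable G : graph.
Hypothesis treeG : is_tree G.

Lemma tree_card_edges : #|edges G| = #|G|.-1.
Proof.
have [/card_gt0P[r _] _] := treeG.1.
have [p [_ p_inj ->]] := level_edges (tree_level treeG.1 r treeG.2).
by rewrite card_in_imset // cardsC1.
Qed.

(** The edge from [v] to its parent contributes [dist u v] and
    [dist u v - 1]. *)
Lemma sum_edges_dist (u : G) :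
  \sum_(e in edges G) \sum_(a in e) dist u a + #|G|.-1 = 2 * \sum_(v : G) dist u v.
Proof.
have [p [pP p_inj ->]] := level_edges (tree_level treeG.1 u treeG.2).
rewrite big_imset //= -(cardsC1 u) -sum1_card -big_split /=.
rewrite big_distrr [RHS](bigD1 u) //= dist_refl.
rewrite muln0 add0n; apply: eq_big => [v|v]; first by rewrite !inE.
by rewrite !inE => /pP[vp fv]; rewrite sum_edge //; lia.
Qed.

(** The ends of an edge have levels k and k + 1, and the sum 2 k + 1 lies
    between the doubled levels 2 k and 2 k + 2. *)
Definition subdivided_level (f : G -> nat) (x : subdivision G) : nat :=
  match x with
  | inl v => 2 * f v
  | inr e => \sum_(a in val e) f a
  end.

Lemma subdivision_level (r : G) (f : G -> nat) : level_function r f ->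
  @level_function (subdivision G) (inl r) (subdivided_level f).
Proof.
move=> lev.
have old_new v (e : {e | e \in edges G}) : v \in val e ->
    2 * f v = (\sum_(a in val e) f a).+1 \/ \sum_(a in val e) f a = (2 * f v).+1.
  case/(edge_at (valP e))=> w vw ->; rewrite sum_edge //.
  by case: (level_adj lev vw); lia.
split=> [|[v|e] [w|e'] //= ve|[v v_r|e _]].
- by rewrite /= (level_root lev).
- exact: old_new.
- by case: (old_new _ _ ve); [right | left].
- have v_r' : v != r by apply: contra_neq v_r => ->.
  have [w wP] := level_parent lev v_r'.
  have /andP[vw /eqP fv] : adj v w && (f v == (f w).+1) by rewrite wP.
  have vw_edge : [set v; w] \in edges G by apply/edgeP; exists v, w.
  exists (inr (Sub [set v; w] vw_edge)) => -[//|e] /=.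
  apply/andP/eqP=> [[v_e]|[->]]; last first.
    by rewrite /= !inE eqxx sum_edge //; split=> //; lia.
  have [x vx def_e] := edge_at (valP e) v_e.
  rewrite def_e sum_edge // => /eqP fx; congr inr; apply: val_inj => /=.
  by rewrite def_e; congr [set _; _]; apply: (level_parent_unique lev vx vw); lia.
have [a [b [ab fa def_e]]] : exists a b, [/\ adj a b, f a = (f b).+1 & val e = [set a; b]].
  have /edgeP[a [b [ab def_e]]] := valP e; case: (level_adj lev ab) => fab.
    by exists a, b.
  by exists b, a; rewrite adj_sym ab setUC.
exists (inl b) => -[c|//] /=; rewrite def_e sum_edge //.
apply/andP/eqP=> [[/set2P[] -> // /eqP]|[->]]; first by lia.
by rewrite !inE eqxx orbT; split=> //; lia.
Qed.

Lemma subdivision_tree : is_tree (subdivision G).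
Proof.
have [/card_gt0P[r _] _] := treeG.1.
exact: level_tree (subdivision_level (tree_level treeG.1 r treeG.2)).
Qed.

Lemma card_subdivision : #|subdivision G| = #|G| + #|G|.-1.
Proof. by rewrite card_sum card_sig -tree_card_edges. Qed.

Lemma sum_dist_old (u : G) :
  \sum_(x : subdivision G) dist (inl u : subdivision G) x + #|G|.-1
  = 4 * \sum_(v : G) dist u v.
Proof.
have lev := subdivision_level (tree_level treeG.1 u treeG.2).
under eq_bigr do rewrite (level_dist lev).
rewrite big_sumType /= -big_distrr /=.
have := sum_edges_dist u; rewrite big_sub /=.
set S := (X in X + _ = _ -> _); set S' := (X in _ -> _ + X + _ = _).
by rewrite -[S']/S; lia.
Qed.

(** The midpoint has degree two, so this follows from [sum_dist_degree2] and
    the value of [sum_dist_old] at both of its neighbours. *)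
Lemma sum_dist_new (e : {e : {set G} | e \in edges G}) :
  \sum_(x : subdivision G) dist (inr e : subdivision G) x + #|G|
  = 2 * \sum_(a in val e) \sum_(v : G) dist a v.
Proof.
have [n_gt0 _] := treeG.1.
have [a [b [ab def_e]]] := edgeP _ (valP e).
have ab' : (inl a : subdivision G) != inl b by apply: contra_neq (adj_neq ab) => -[].
have nbr x : adj (inr e : subdivision G) x = (x \in [set inl a; inl b]).
  by case: x => [c|f]; rewrite /= ?def_e !inE.
have mean := sum_dist_degree2 subdivision_tree ab' nbr.
rewrite def_e sum_edge //; have := sum_dist_old a; have := sum_dist_old b.
by lia.
Qed.

End SubdividedTree.

(** * The geodesic distance of the subdivisions *)

Lemma geodesic_distance_double (G : graph) : connected G ->
  2 * geodesic_distance G = \sum_(u : G) \sum_(v : G) dist u v.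
Proof.
move=> conn; rewrite mul2n -addnn.
rewrite {2}/geodesic_distance (exchange_big_dep xpredT) //= /geodesic_distance -big_split /=.
apply: eq_bigr => u _; rewrite [RHS](bigID (fun v => enum_rank u < enum_rank v)) /=.
congr (_ + _); rewrite [RHS](bigD1 u) ?ltnn //= dist_refl add0n.
apply: eq_big => [v|v _]; last exact: distC.
rewrite -leqNgt ltn_neqAle andbC; congr (_ && _).
by rewrite (inj_eq val_inj) (inj_eq enum_rank_inj).
Qed.

(** The identity S' = 8 S - 2 n (n - 1), obtained by summing [sum_dist_old] and
    [sum_dist_new]; the double sum over the edges in the latter is evaluated by
    [sum_edges_dist]. *)
Lemma geodesic_distance_subdivision (G : graph) : is_tree G ->
  geodesic_distance (subdivision G) + 2 * (#|G| * #|G|.-1) = 8 * geodesic_distance G.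
Proof.
move=> treeG; have treeS := subdivision_tree treeG.
suff : 2 * geodesic_distance (subdivision G) + 4 * (#|G| * #|G|.-1)
       = 8 * (2 * geodesic_distance G) by lia.
rewrite (geodesic_distance_double treeS.1) (geodesic_distance_double treeG.1).
set W := (X in _ = 8 * X); rewrite big_sumType /=.
have old : \sum_(u : G) \sum_(x : subdivision G) dist (inl u : subdivision G) x
           + #|G| * #|G|.-1 = 4 * W.
  rewrite big_distrr /= -(eq_bigr _ (fun u _ => sum_dist_old treeG u)) big_split /=.
  by rewrite sum_nat_const.
have ends : \sum_(e in edges G) \sum_(a in e) \sum_(v : G) dist a v
            + #|G| * #|G|.-1 = 2 * W.
  rewrite [2 * W]big_distrr /= -(eq_bigr _ (fun u _ => sum_edges_dist treeG u)).
  rewrite big_split /= sum_nat_const; congr (_ + _).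
  rewrite [RHS]exchange_big /=; apply: eq_bigr => e _.
  rewrite [RHS]exchange_big /=; apply: eq_bigr => a _; apply: eq_bigr => v _.
  exact: distC treeG.1.
have new : \sum_(e : {e | e \in edges G})
             \sum_(x : subdivision G) dist (inr e : subdivision G) x
           + #|G|.-1 * #|G| = 2 * \sum_(e in edges G) \sum_(a in e) \sum_(v : G) dist a v.
  rewrite [in RHS]big_sub big_distrr /= -(eq_bigr _ (fun e _ => sum_dist_new treeG e)).
  by rewrite big_split /= sum_nat_const card_sig -(tree_card_edges treeG).
have arith (A B E n m : nat) : A + n * m = 4 * W -> E + n * m = 2 * W ->
    B + m * n = 2 * E -> A + B + 4 * (n * m) = 8 * W by lia.
exact: arith old ends new.
Qed.

Import GRing.Theory.
Local Open Scope ring_scope.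

Lemma iter_subdivision_tree (G : graph) (t : nat) :
  is_tree G -> is_tree (iter_subdivision t G).
Proof. by move=> treeG; elim: t => //= t; apply: subdivision_tree. Qed.

(** The quantity #|G| - 1 is the number of edges, which each subdivision
    doubles. *)
Lemma card_iter_subdivision (G : graph) (t : nat) : is_tree G ->
  #|iter_subdivision t G|%:R - 1 = 2 ^+ t * (#|G|%:R - 1) :> rat.
Proof.
move=> treeG; elim: t => [|t IH]; first by rewrite expr0 mul1r.
have tree_t := iter_subdivision_tree t treeG.
rewrite exprS -mulrA -{}IH /= card_subdivision //.
have [n_gt0 _] := tree_t.1; rewrite natrD -subn1 natrB //; ring.
Qed.

(** The solution of the recurrence, written with powers of [2 ^+ t] so that it
    holds for [t = 0] and the induction can start there. *)
Lemma geodesic_distance_iter (G : graph) (t : nat) : is_tree G ->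
  (geodesic_distance (iter_subdivision t G))%:R =
    8 ^+ t * (geodesic_distance G)%:R
    - 1 / 3 * ((2 ^+ t) ^+ 3 - 2 ^+ t) * (#|G|%:R - 1)
    + 1 / 2 * ((2 ^+ t) ^+ 2 - (2 ^+ t) ^+ 3) * (#|G|%:R - 1) ^+ 2 :> rat.
Proof.
move=> treeG; elim: t => [|t IH]; first by rewrite !expr0; ring.
have tree_t := iter_subdivision_tree t treeG.
have [n_gt0 _] := tree_t.1.
have := congr1 (fun n => n%:R : rat) (geodesic_distance_subdivision tree_t).
rewrite natrD !natrM -subn1 natrB // {}IH card_iter_subdivision //.
have -> : #|iter_subdivision t G|%:R = 2 ^+ t * (#|G|%:R - 1) + 1 :> rat.
  by rewrite -card_iter_subdivision // subrK.
move/(canRL (addrK _)) => ->; rewrite !exprS; by field.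
Qed.

Theorem corollary1 (T : graph) (hT : is_tree T) (t : nat) (ht : (1 <= t)%N) :
  (geodesic_distance (iter_subdivision t T))%:R =
    8 ^+ t * (geodesic_distance T)%:R
    - 1 / 3 * (2 ^+ (3 * t) - 2 ^+ t) * (#|T|%:R - 1)
    + (2 ^+ (2 * t - 1) - 2 ^+ (3 * t - 1)) * (#|T|%:R - 1) ^+ 2 :> rat.
Proof.
have half k : (0 < k)%N -> 2 ^+ (k - 1) = 1 / 2 * 2 ^+ k :> rat.
  by case: k => // k _; rewrite subn1 exprS mulrA divfK // mul1r.
rewrite geodesic_distance_iter // !half ?muln_gt0 // -!exprM.
by rewrite ![(t * _)%N]mulnC; ring.
Qed.
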